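(* (1) Let $\Phi:H_n\to H_k$ be a unital trace-preserving linear map and $\Omega: H_m\to H_l$ a completely positive linear map. Then \[ \|\Phi\otimes\Omega\|_{1\to2}\leq\sqrt{\gamma(\Phi)}\,\|\Omega\|_{1\to2}, \] and, if moreover $\Phi$ and $\Omega$ are quantum channels, then for every $0\le\alpha\le2$, \[ S_{\min,\alpha}(\Phi\otimes\Omega)\geq-\log\gamma(\Phi)+S_{\min,2}(\Omega). \] (2) For any $N\in\mathbb N$ and unital quantum channels $\Phi_i:H_{n_i}\to H_{k_i}$, $i=1,\dots,N$, and every $0\le\alpha\le2$, \[ \left\|\bigotimes_{i=1}^N\Phi_i\right\|_{1\to2}\leq\prod_{i=1}^N\sqrt{\gamma(\Phi_i)}\qquad\text{and}\qquad S_{\min,\alpha}\left(\bigotimes_{i=1}^N\Phi_i\right)\geq-\sum_{i=1}^N\log\gamma(\Phi_i). \]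
   Context: $H_n$ is the real vector space of $n\times n$ Hermitian matrices with inner product ${\rm Tr}(XY)$, $H_{n,0}$ its traceless subspace, and $H_{n,+,1}$ the set of density matrices. A quantum channel is a completely positive trace-preserving map; a map $\Phi:H_n\to H_k$ is unital if $\Phi(I_n/n)=I_k/k$. For a linear map $\Phi$, $\|\Phi\|_{1\to2}=\max_{0\neq\rho}\|\Phi(\rho)\|_2/\|\rho\|_1$ over nonzero Hermitian $\rho$ (Schatten norms). The Rényi entropy is $S_\alpha(\sigma)=\frac1{1-\alpha}\log{\rm Tr}\,\sigma^\alpha$ (limits at $\alpha=0,1$; $S_1$ is the von Neumann entropy), and $S_{\min,\alpha}(\Phi)=\min_{\rho\in H_{n,+,1}}S_\alpha(\Phi(\rho))$ for a channel $\Phi$. For a unital trace-preserving $\Phi:H_n\to H_k$, fix an orthonormal basis $M_1,\dots,M_{n^2-1}$ of $H_{n,0}$, let $(A_\Phi)_{i,j}={\rm Tr}[\Phi(M_i)\Phi(M_j)]$ with largest eigenvalue $\|A_\Phi\|_\infty$ (basis independent), and set $\gamma(\Phi)=\frac1k+\left(1-\frac1n\right)\|A_\Phi\|_\infty$ if $n\ge k\|A_\Phi\|_\infty$ and $\gamma(\Phi)=\|A_\Phi\|_\infty$ otherwise. *)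

(* Defs.v *)
From HB Require Import structures.
From mathcomp Require Import all_boot all_order all_algebra.
From mathcomp Require Import complex mxtens.
From mathcomp Require Import boolp classical_sets reals exp.

Set Implicit Arguments.
Unset Strict Implicit.
Unset Printing Implicit Defensive.

Import Order.TTheory GRing.Theory Num.Theory.
Local Open Scope ring_scope.
Local Open Scope classical_set_scope.

Section QuantumDefs.
Variable R : realType.
Local Notation C := (R[i]).

Definition ctr m n (A : 'M[C]_(m, n)) : 'M[C]_(n, m) := (map_mx Num.conj A)^T.

Definition hermitian n (A : 'M[C]_n) : bool := ctr A == A.

Definition psd n (A : 'M[C]_n) : Prop :=
  hermitian A /\ forall v : 'rV[C]_n, 0 <= (v *m A *m ctr v) 0 0.

Definition density n (A : 'M[C]_n) : Prop := psd A /\ \tr A = 1.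

(* eigenvalues (with multiplicity) of a normal (e.g. Hermitian) matrix,
   real parts taken (they are real for Hermitian matrices) *)
Definition eigs n (A : 'M[C]_n) (i : 'I_n) : R := complex.Re (spectral_diag A 0 i).

Definition schatten1 m n (A : 'M[C]_(m, n)) : R :=
  \sum_(i < n) Num.sqrt (eigs (ctr A *m A) i).

Definition schatten2 m n (A : 'M[C]_(m, n)) : R :=
  Num.sqrt (complex.Re (\tr (ctr A *m A))).

Definition norm12 n k (Phi : 'M[C]_n -> 'M[C]_k) : R :=
  sup [set x : R | exists2 rho : 'M[C]_n,
        hermitian rho && (rho != 0) & x = schatten2 (Phi rho) / schatten1 rho].

(* tensor product of linear maps on matrices:
   (Phi (x) Omega)(E_ij (x) E_pq) = Phi(E_ij) (x) Omega(E_pq), extended linearly *)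
Definition tensmap n k m l (Phi : 'M[C]_n -> 'M[C]_k) (Omega : 'M[C]_m -> 'M[C]_l)
  (X : 'M[C]_(n * m)) : 'M[C]_(k * l) :=
  \sum_(i < n) \sum_(j < n) \sum_(p < m) \sum_(q < m)
     X (mxtens_index (i, p)) (mxtens_index (j, q))
       *: tensmx (Phi (delta_mx i j)) (Omega (delta_mx p q)).

(* A map on matrices coming from a linear map H_n -> H_k: complex-linear
   (complexification) and Hermiticity preserving *)
Definition herm_linear n k (Phi : 'M[C]_n -> 'M[C]_k) : Prop :=
  linear Phi /\ forall X, hermitian X -> hermitian (Phi X).

Definition trace_preserving n k (Phi : 'M[C]_n -> 'M[C]_k) : Prop :=
  forall X, hermitian X -> \tr (Phi X) = \tr X.

Definition unital n k (Phi : 'M[C]_n -> 'M[C]_k) : Prop :=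
  Phi (n%:R^-1 *: 1%:M) = k%:R^-1 *: 1%:M.

Definition completely_positive m l (Omega : 'M[C]_m -> 'M[C]_l) : Prop :=
  forall r (X : 'M[C]_(r * m)), psd X -> psd (tensmap (@id 'M[C]_r) Omega X).

Definition quantum_channel n k (Phi : 'M[C]_n -> 'M[C]_k) : Prop :=
  herm_linear Phi /\ completely_positive Phi /\ trace_preserving Phi.

(* Renyi entropy; S_1 = von Neumann entropy, S_0 = log rank (limits);
   Tr sigma^alpha is taken over the support of sigma (0^alpha = 0) *)
Definition renyi (alpha : R) n (sigma : 'M[C]_n) : R :=
  if alpha == 1 then
    - \sum_(i < n | 0 < eigs sigma i) eigs sigma i * ln (eigs sigma i)
  else (1 - alpha)^-1 * ln (\sum_(i < n | 0 < eigs sigma i) powR (eigs sigma i) alpha).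

(* minimal output Renyi entropy (min = inf over the compact set of states) *)
Definition Smin (alpha : R) n k (Phi : 'M[C]_n -> 'M[C]_k) : R :=
  inf [set x : R | exists2 rho : 'M[C]_n, density rho & x = renyi alpha (Phi rho)].

Definition onb_traceless n (M : 'I_(n ^ 2 - 1) -> 'M[C]_n) : Prop :=
  (forall i, hermitian (M i) /\ \tr (M i) = 0) /\
  (forall i j, \tr (M i *m M j) = (i == j)%:R).

Definition Amat n k (M : 'I_(n ^ 2 - 1) -> 'M[C]_n) (Phi : 'M[C]_n -> 'M[C]_k)
  : 'M[C]_(n ^ 2 - 1) :=
  \matrix_(i, j) \tr (Phi (M i) *m Phi (M j)).

(* ||A_Phi||_infty : the largest eigenvalue of A_Phi (0 for the empty matrix) *)
Definition Anorm n k (M : 'I_(n ^ 2 - 1) -> 'M[C]_n) (Phi : 'M[C]_n -> 'M[C]_k) : R :=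
  \big[Num.max/0]_(i < n ^ 2 - 1) eigs (Amat M Phi) i.

Definition gamma n k (M : 'I_(n ^ 2 - 1) -> 'M[C]_n) (Phi : 'M[C]_n -> 'M[C]_k) : R :=
  if k%:R * Anorm M Phi <= n%:R then k%:R^-1 + (1 - n%:R^-1) * Anorm M Phi
  else Anorm M Phi.

Record qmap := QMap { din : nat; dout : nat; qfun : 'M[C]_din -> 'M[C]_dout }.
Arguments qfun : clear implicits.

Definition qtens (a b : qmap) : qmap := QMap (tensmap (qfun a) (qfun b)).

Fixpoint qtens_seq (s : seq qmap) : qmap :=
  match s with
  | [::] => @QMap 1 1 id
  | [:: a] => a
  | a :: s' => qtens a (qtens_seq s')
  end.

End QuantumDefs.
Arguments qfun {R} q _.

(* Main.v *)
(* Write [Phi (x) Omega] applied to a pure state with component vectors psi_i as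
   sum_ij Phi(E_ij) (x) Y_ij with Y_ij = Omega(psi_i psi_j^H).  Entrywise in the
   second factor this is Phi evaluated at the matrix x of the corresponding entries
   of the Y_ij, and expanding x on I and the basis M_i gives
     |Phi x|_2^2 <= (1/k - |A|/n) |tr x|^2 + |A| |x|_2^2.
   Summing over entries bounds the output by
     (1/k - |A|/n) |sum_i Y_ii|_2^2 + |A| sum_ij |Y_ij|_2^2,
   and both squares are at most (sum_i |Y_ii|_2)^2: the first by the triangle
   inequality, the second because Kraus operators give Y_ij = U_i U_j^H, so that
   Cauchy-Schwarz yields |Y_ij|_2^2 <= |Y_ii|_2 |Y_jj|_2.  Mixed inputs reduce to
   pure ones by the spectral theorem.  For the entropies, S_alpha >= S_2 when
   alpha <= 2, which follows from ln x <= x - 1. *)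

Require Import Defs.
From HB Require Import structures.
From mathcomp Require Import all_boot all_order all_algebra.
From mathcomp Require Import complex mxtens.
From mathcomp Require Import boolp classical_sets reals sequences exp.
From mathcomp Require Import ring lra.
(* Imported again because [sesquilinear] also exports the name [hermitian]. *)
Import Defs.

Set Implicit Arguments.
Unset Strict Implicit.
Unset Printing Implicit Defensive.

Import Order.TTheory GRing.Theory Num.Theory.
Local Open Scope ring_scope.
Local Open Scope complex_scope.

(** * The Hilbert-Schmidt norm: triangle inequality, Cauchy-Schwarz and products *)

Section HilbertSchmidt.
Context {R : realType}.
Local Notation C := (R[i]).

(** Bundles a map whose linearity is only a hypothesis, so that [linear_sum] and [linearZ] apply
    after folding [F] into the bundled form. *)
Definition as_linear m n (F : 'M[C]_m -> 'M[C]_n) (linF : linear F) :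
  {linear 'M[C]_m -> 'M[C]_n} := HB.pack F (GRing.isLinear.Build _ _ _ _ F linF).

Lemma real_complex_real (a : R) : a%:C \is Num.real.
Proof. by apply/complex_realP; exists a. Qed.

Lemma conj_real_complex (a : R) : (a%:C^*)%R = a%:C.
Proof. exact/CrealP/real_complex_real. Qed.

Lemma ReK (x : C) : 0 <= x -> (complex.Re x)%:C = x.
Proof. by move=> /ger0_real/RRe_real. Qed.

Lemma norm_real_complex (a : R) : `|a%:C| = `|a|%:C.
Proof. by rewrite normc_def /= expr0n addr0 sqrtr_sqr. Qed.

Lemma ctrE m n (A : 'M[C]_(m, n)) i j : ctr A i j = ((A j i)^*)%R.
Proof. by rewrite !mxE. Qed.

Lemma ctrK m n (A : 'M[C]_(m, n)) : ctr (ctr A) = A.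
Proof. by apply/matrixP => i j; rewrite !ctrE conjCK. Qed.

Lemma ctr_mul m n p (A : 'M[C]_(m, n)) (B : 'M[C]_(n, p)) :
  ctr (A *m B) = ctr B *m ctr A.
Proof. by rewrite /ctr map_mxM trmx_mul. Qed.

Lemma ctr_sum m n (I : finType) (F : I -> 'M[C]_(m, n)) :
  ctr (\sum_i F i) = \sum_i ctr (F i).
Proof. by rewrite /ctr !raddf_sum. Qed.

Lemma ctr_scale m n (a : C) (A : 'M[C]_(m, n)) : ctr (a *: A) = (a^*)%R *: ctr A.
Proof. by apply/matrixP => i j; rewrite !mxE rmorphM. Qed.

Lemma trace_ctr_mul m n (A B : 'M[C]_(m, n)) :
  \tr (ctr A *m B) = \sum_i \sum_j ((A i j)^*)%R * B i j.
Proof.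
rewrite /mxtrace exchange_big /=; apply: eq_bigr => j _.
by rewrite mxE; apply: eq_bigr => i _; rewrite ctrE.
Qed.

(** Vectorisation is an isometry for the trace inner product; the triangle inequality and
    Cauchy-Schwarz for [dotmx] pass to [schatten2] through it. *)
Lemma dotmx_mxvec m n (A B : 'M[C]_(m, n)) :
  dotmx (mxvec A) (mxvec B) = \tr (ctr B *m A).
Proof.
rewrite dotmxE trace_ctr_mul mxE pair_big /=.
rewrite (reindex _ (curry_mxvec_bij _ _)) /=.
by apply: eq_bigr => -[i j] _; rewrite !mxE !mxvecE mulrC.
Qed.

Lemma schatten2_ge0 m n (A : 'M[C]_(m, n)) : 0 <= schatten2 A.
Proof. exact: sqrtr_ge0. Qed.

Lemma trace_ctr_mul_ge0 m n (A : 'M[C]_(m, n)) : 0 <= \tr (ctr A *m A).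
Proof.
rewrite trace_ctr_mul; apply: sumr_ge0 => i _; apply: sumr_ge0 => j _.
by rewrite mulrC mul_conjC_ge0.
Qed.

Lemma schatten2_sqr_trace m n (A : 'M[C]_(m, n)) :
  (schatten2 A ^+ 2)%:C = \tr (ctr A *m A).
Proof.
have h := trace_ctr_mul_ge0 A.
by rewrite sqr_sqrtr ?ReK //; move: h; rewrite lecE => /andP[].
Qed.

Lemma schatten2_sqr m n (A : 'M[C]_(m, n)) :
  (schatten2 A ^+ 2)%:C = \sum_i \sum_j `|A i j| ^+ 2.
Proof.
rewrite schatten2_sqr_trace trace_ctr_mul.
by apply: eq_bigr => i _; apply: eq_bigr => j _; rewrite normCK mulrC.
Qed.

Lemma schatten2_sqrtC m n (A : 'M[C]_(m, n)) :
  (schatten2 A)%:C = sqrtC (dotmx (mxvec A) (mxvec A)).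
Proof.
by rewrite dotmx_mxvec -schatten2_sqr_trace rmorphXn sqrCK // ler0c schatten2_ge0.
Qed.

Lemma schatten2D m n (A B : 'M[C]_(m, n)) :
  schatten2 (A + B) <= schatten2 A + schatten2 B.
Proof.
rewrite -lecR rmorphD /= !schatten2_sqrtC raddfD /=.
exact: (triangle_lerif (@dotmx C _)).
Qed.

Lemma normC_trace_ctr_mul m n (A B : 'M[C]_(m, n)) :
  `|\tr (ctr A *m B)| <= (schatten2 A * schatten2 B)%:C.
Proof.
rewrite rmorphM /= !schatten2_sqrtC mulrC -dotmx_mxvec.
exact: (CauchySchwarz_sqrt (@dotmx C _)).
Qed.

Lemma schatten2Z m n (a : C) (A : 'M[C]_(m, n)) :
  (schatten2 (a *: A))%:C = `|a| * (schatten2 A)%:C.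
Proof.
apply/eqP; rewrite -(@eqrXn2 _ 2) ?ler0c ?schatten2_ge0 //; last first.
  by apply: mulr_ge0; [exact: normr_ge0 | rewrite ler0c schatten2_ge0].
have sqr (B : 'M[C]_(m, n)) : (schatten2 B)%:C ^+ 2 = \sum_i \sum_j `|B i j| ^+ 2.
  by rewrite -schatten2_sqr rmorphXn.
rewrite exprMn !sqr mulr_sumr; apply/eqP.
apply: eq_bigr => i _; rewrite mulr_sumr; apply: eq_bigr => j _.
by rewrite mxE normrM exprMn.
Qed.

Lemma schatten2Zr m n (a : R) (A : 'M[C]_(m, n)) :
  schatten2 (a%:C *: A) = `|a| * schatten2 A.
Proof. by apply: complexI; rewrite schatten2Z norm_real_complex rmorphM. Qed.

Lemma schatten2_0 m n : schatten2 (0 : 'M[C]_(m, n)) = 0.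
Proof. by rewrite -(scale0r (0 : 'M[C]_(m, n))) schatten2Zr normr0 mul0r. Qed.

Lemma schatten2_sum m n (I : finType) (F : I -> 'M[C]_(m, n)) :
  schatten2 (\sum_i F i) <= \sum_i schatten2 (F i).
Proof.
apply: (big_ind2 (fun A x => schatten2 A <= x)) => [|A x B y hA hB|//].
  by rewrite schatten2_0.
exact: le_trans (schatten2D _ _) (lerD hA hB).
Qed.

(** By cyclicity, tr((AB)^H AB) is the inner product of A^H A with B B^H, to which Cauchy-Schwarz
    applies. This is what controls the off-diagonal blocks of the output. *)
Lemma schatten2_mul m n p (A : 'M[C]_(m, n)) (B : 'M[C]_(n, p)) :
  schatten2 (A *m B) ^+ 2 <= schatten2 (ctr A *m A) * schatten2 (B *m ctr B).
Proof.
have e : \tr (ctr (A *m B) *m (A *m B)) = \tr (ctr (ctr A *m A) *m (B *m ctr B)).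
  by rewrite !ctr_mul ctrK -!mulmxA [LHS]mxtrace_mulC !mulmxA.
rewrite -lecR schatten2_sqr_trace; apply: le_trans (normC_trace_ctr_mul _ _).
by rewrite -e ger0_norm // trace_ctr_mul_ge0.
Qed.

Lemma schatten2_mulC m n (A : 'M[C]_(m, n)) :
  schatten2 (ctr A *m A) = schatten2 (A *m ctr A).
Proof.
rewrite /schatten2 !ctr_mul !ctrK; congr (Num.sqrt (complex.Re _)).
by rewrite -!mulmxA [LHS]mxtrace_mulC !mulmxA.
Qed.

End HilbertSchmidt.

(** * Spectral decomposition of Hermitian matrices and the trace norm *)

Section Spectrum.
Context {R : realType}.
Local Notation C := (R[i]).

Lemma hermitian_hermsymmx n (A : 'M[C]_n) : hermitian A -> A \is hermsymmx.
Proof.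
move=> /eqP hA; apply/is_hermitianmxP; rewrite expr0 scale1r.
by rewrite -[LHS]hA /ctr map_trmx.
Qed.

Lemma eigsE n (A : 'M[C]_n) i : hermitian A -> (eigs A i)%:C = spectral_diag A 0 i.
Proof.
move=> /hermitian_hermsymmx/hermitian_spectral_diag_real/mxOverP/(_ 0 i).
exact: RRe_real.
Qed.

Lemma spectralmx_ctr n (A : 'M[C]_n) : spectralmx A *m ctr (spectralmx A) = 1%:M.
Proof.
by have /unitarymxP := spectral_unitarymx A; rewrite /ctr map_trmx.
Qed.

Lemma ctr_spectralmx n (A : 'M[C]_n) : ctr (spectralmx A) *m spectralmx A = 1%:M.
Proof. exact/mulmx1C/spectralmx_ctr. Qed.

Lemma hermitian_spectral n (A : 'M[C]_n) : hermitian A ->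
  A = ctr (spectralmx A) *m diag_mx (\row_i (eigs A i)%:C) *m spectralmx A.
Proof.
move=> hA; have /hermitian_hermsymmx/hermitian_normalmx/orthomx_spectralP := hA.
rewrite invmx_unitary ?spectral_unitarymx // /ctr map_trmx => {1}->.
by congr (_ *m diag_mx _ *m _); apply/rowP => i; rewrite mxE eigsE.
Qed.

(** X - PDQ factors as P (X - D) Q, and det P det Q = 1. *)
Lemma char_poly_conj n (P Q D : 'M[C]_n) : Q *m P = 1%:M ->
  char_poly (P *m D *m Q) = char_poly D.
Proof.
move=> QP; have PQ := mulmx1C QP; rewrite /char_poly.
have -> : char_poly_mx (P *m D *m Q) =
    map_mx polyC P *m char_poly_mx D *m map_mx polyC Q.
  rewrite /char_poly_mx mulmxBr mulmxBl !map_mxM; congr (_ - _).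
  by rewrite scalar_mxC -mulmxA -map_mxM PQ map_mx1 mulmx1.
by rewrite !det_mulmx mulrAC -det_mulmx -map_mxM PQ map_mx1 det1 mul1r.
Qed.

(** [eigs] refers to one chosen diagonalisation. Any other unitary diagonalisation has the same
    characteristic polynomial, hence the same roots up to order, and symmetric sums agree. This
    gives access to the eigenvalues of A^H A in [schatten1]. *)
Lemma sum_eigs_conj n (P : 'M[C]_n) (d : 'I_n -> R) (f : R -> R) :
  P *m ctr P = 1%:M ->
  \sum_i f (eigs (ctr P *m diag_mx (\row_i (d i)%:C) *m P) i) = \sum_i f (d i).
Proof.
move=> PP; set A := _ *m P.
have hA : hermitian A.
  apply/eqP; rewrite /A !ctr_mul ctrK mulmxA; congr (_ *m _ *m _).
  apply/matrixP => i j; rewrite ctrE !mxE rmorphMn /= eq_sym.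
  by case: eqP => [->|]; rewrite ?mulr1n ?mulr0n // conj_real_complex.
have perm : perm_eq [seq spectral_diag A 0 i | i <- index_enum 'I_n]
                    [seq (d i)%:C | i <- index_enum 'I_n].
  apply: prod_XsubC_eq; rewrite 2!big_map.
  have diag (e : 'rV[C]_n) : char_poly (diag_mx e) = \prod_(i < n) ('X - (e 0 i)%:P).
    rewrite char_poly_trig ?diag_mx_is_trig //.
    by apply: eq_bigr => i _; rewrite mxE eqxx.
  rewrite -[LHS]diag -(char_poly_conj _ (spectralmx_ctr A)).
  have -> : spectral_diag A = \row_i (eigs A i)%:C.
    by apply/rowP => i; rewrite mxE eigsE.
  rewrite -hermitian_spectral // /A char_poly_conj // diag.
  by apply: eq_bigr => i _; rewrite mxE.
pose g (x : C) := f (complex.Re x).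
have := perm_big (op := +%R) (x := 0) _ perm (P := xpredT) (F := g).
by rewrite /= 2!big_map.
Qed.

Lemma psd_mul_ctr m n (A : 'M[C]_(m, n)) : psd (A *m ctr A).
Proof.
split; first by rewrite /hermitian ctr_mul ctrK.
move=> v; rewrite mulmxA -mulmxA -ctr_mul mxE; apply: sumr_ge0 => i _.
by rewrite ctrE mul_conjC_ge0.
Qed.

Lemma hermitian_diagonalize n (A : 'M[C]_n) : hermitian A ->
  spectralmx A *m A *m ctr (spectralmx A) = diag_mx (\row_i (eigs A i)%:C).
Proof.
move=> hA; rewrite [X in _ *m X *m _](hermitian_spectral hA) !mulmxA.
by rewrite spectralmx_ctr mul1mx -mulmxA spectralmx_ctr mulmx1.
Qed.

(** The i-th eigenvalue is the value of the quadratic form at the i-th row of the diagonalising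
    unitary. *)
Lemma psd_eigs_ge0 n (A : 'M[C]_n) i : psd A -> 0 <= eigs A i.
Proof.
move=> [hA /(_ (row i (spectralmx A)))]; rewrite -row_mul mxE.
have := congr1 (fun B : 'M_n => B i i) (hermitian_diagonalize hA).
rewrite [LHS]mxE [RHS]mxE mxE eqxx mulr1n -ler0c => <-.
congr (0 <= _); apply: eq_bigr => j _.
by rewrite !ctrE !mxE.
Qed.

Lemma hermitian_sum_pure n (A : 'M[C]_n) : hermitian A ->
  exists v : 'I_n -> 'cV[C]_n, (forall i, schatten2 (v i) = 1) /\
    A = \sum_i (eigs A i)%:C *: (v i *m ctr (v i)).
Proof.
move=> hA; exists (fun i => col i (ctr (spectralmx A))); split => [i|].
  apply/eqP; rewrite -(@eqrXn2 _ 2) ?schatten2_ge0 // expr1n; apply/eqP.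
  apply: complexI; rewrite schatten2_sqr_trace trace_mx11 mxE.
  have := congr1 (fun B : 'M_n => B i i) (spectralmx_ctr A).
  rewrite [LHS]mxE [RHS]mxE eqxx mulr1n rmorph1 => <-.
  by apply: eq_bigr => j _; rewrite !ctrE !mxE conjCK.
rewrite {1}(hermitian_spectral hA); apply/matrixP => a b.
rewrite mxE summxE; apply: eq_bigr => i _.
by rewrite mul_mx_diag !mxE big_ord1 !mxE conjCK mulrAC mulrC mulrA.
Qed.

Lemma mxtrace_eigs n (A : 'M[C]_n) : hermitian A ->
  \tr A = (\sum_i eigs A i)%:C.
Proof.
move=> hA; rewrite {1}(hermitian_spectral hA) -mulmxA mxtrace_mulC -mulmxA.
rewrite spectralmx_ctr mulmx1 mxtrace_diag rmorph_sum /=.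
by apply: eq_bigr => i _; rewrite mxE.
Qed.

Lemma hermitian_sqr n (A : 'M[C]_n) : hermitian A ->
  ctr A *m A =
  ctr (spectralmx A) *m diag_mx (\row_i (eigs A i ^+ 2)%:C) *m spectralmx A.
Proof.
move=> hA; move: (hA) => /eqP ->.
rewrite {1 2}(hermitian_spectral hA) -!mulmxA (mulmxA (spectralmx A) (ctr _)).
rewrite spectralmx_ctr mul1mx (mulmxA (diag_mx _)) mulmx_diag.
congr (_ *m (diag_mx _ *m _)); apply/rowP => i.
by rewrite !mxE -rmorphM.
Qed.

Lemma schatten1_hermitian n (A : 'M[C]_n) : hermitian A ->
  schatten1 A = \sum_i `|eigs A i|.
Proof.
move=> hA; rewrite /schatten1 hermitian_sqr //.
rewrite (sum_eigs_conj _ Num.sqrt (spectralmx_ctr A)).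
by apply: eq_bigr => i _; rewrite sqrtr_sqr.
Qed.

Lemma schatten2_hermitian n (A : 'M[C]_n) : hermitian A ->
  schatten2 A ^+ 2 = \sum_i eigs A i ^+ 2.
Proof.
move=> hA; apply: complexI; rewrite schatten2_sqr_trace hermitian_sqr //.
rewrite -mulmxA mxtrace_mulC -mulmxA spectralmx_ctr mulmx1 mxtrace_diag.
by rewrite [RHS]rmorph_sum /=; apply: eq_bigr => i _; rewrite mxE.
Qed.

Lemma schatten1_psd n (A : 'M[C]_n) : psd A -> (schatten1 A)%:C = \tr A.
Proof.
move=> pA; have [hA _] := pA; rewrite schatten1_hermitian // mxtrace_eigs //.
by congr (_%:C); apply: eq_bigr => i _; rewrite ger0_norm // psd_eigs_ge0.
Qed.

Lemma schatten1_pure m n (A : 'M[C]_(m, n)) :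
  schatten1 (A *m ctr A) = schatten2 A ^+ 2.
Proof.
apply: complexI; rewrite schatten1_psd ?schatten2_sqr_trace; last exact: psd_mul_ctr.
by rewrite mxtrace_mulC.
Qed.

Lemma schatten1_ge0 n (A : 'M[C]_n) : 0 <= schatten1 A.
Proof. by apply: sumr_ge0 => i _; exact: sqrtr_ge0. Qed.

Lemma schatten1_gt0 n (A : 'M[C]_n) : hermitian A -> A != 0 -> 0 < schatten1 A.
Proof.
move=> hA; apply: contra_neqT; rewrite -leNgt => A0.
have : schatten1 A = 0 by apply/eqP; rewrite eq_le A0 schatten1_ge0.
rewrite schatten1_hermitian // => /eqP; rewrite psumr_eq0 => [/allP e0|//].
rewrite (hermitian_spectral hA).
suff -> : \row_i (eigs A i)%:C = 0 by rewrite raddf0 mulmx0 mul0mx.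
apply/rowP => i; rewrite !mxE; have := e0 i (mem_index_enum i).
by rewrite normr_eq0 => /eqP ->.
Qed.

(** W is the adjoint of the diagonalising unitary with its columns scaled by the square roots of the
    eigenvalues. *)
Lemma psd_factor n (A : 'M[C]_n) : psd A -> exists W : 'M[C]_n, A = W *m ctr W.
Proof.
move=> pA; have [hA _] := pA.
exists (ctr (spectralmx A) *m diag_mx (\row_i (Num.sqrt (eigs A i))%:C)).
rewrite ctr_mul ctrK {1}(hermitian_spectral hA) -!mulmxA; congr (_ *m _).
rewrite mulmxA; congr (_ *m _).
have -> : ctr (diag_mx (\row_i (Num.sqrt (eigs A i))%:C)) =
          diag_mx (\row_i (Num.sqrt (eigs A i))%:C).
  apply/matrixP => i j; rewrite ctrE !mxE rmorphMn /= eq_sym.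
  by case: eqP => [->|]; rewrite ?mulr1n ?mulr0n // conj_real_complex.
rewrite mulmx_diag; congr diag_mx; apply/rowP => i.
by rewrite !mxE -rmorphM /= -expr2 sqr_sqrtr // psd_eigs_ge0.
Qed.

(** Triangle inequality along the spectral decomposition into unit rank-one projections: the weights
    are the eigenvalues, whose absolute values sum to the trace norm. *)
Lemma schatten2_le_pure m k (F : 'M[C]_m -> 'M[C]_k) c : linear F ->
  (forall v : 'cV[C]_m, schatten2 (F (v *m ctr v)) <= c * schatten2 v ^+ 2) ->
  forall A, hermitian A -> schatten2 (F A) <= c * schatten1 A.
Proof.
move=> linF hF A hA; pose G := as_linear linF.
have [v [v1 eA]] := hermitian_sum_pure hA.
rewrite schatten1_hermitian // mulr_sumr {1}eA -[F]/(G : _ -> _) linear_sum.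
apply: le_trans (schatten2_sum _) _; apply: ler_sum => i _.
rewrite linearZ schatten2Zr mulrC ler_wpM2r //.
by apply: le_trans (hF _) _; rewrite v1 expr1n mulr1.
Qed.

End Spectrum.

(** * Quadratic forms, and splitting a matrix into scalar and traceless parts *)

Section UnitalMaps.
Context {R : realType}.
Local Notation C := (R[i]).

Lemma hermitian_form_le n (A : 'M[C]_n) (a : R) (r : 'rV[C]_n) :
  hermitian A -> (forall i, eigs A i <= a) ->
  (r *m A *m ctr r) 0 0 <= a%:C * (r *m ctr r) 0 0.
Proof.
move=> hA ha; pose s := r *m ctr (spectralmx A).
have -> : r *m A *m ctr r = s *m diag_mx (\row_i (eigs A i)%:C) *m ctr s.
  by rewrite {1}(hermitian_spectral hA) /s ctr_mul ctrK !mulmxA.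
have -> : r *m ctr r = s *m ctr s.
  by rewrite /s ctr_mul ctrK !mulmxA -(mulmxA r) ctr_spectralmx mulmx1.
rewrite mul_mx_diag !mxE mulr_sumr; apply: ler_sum => i _.
rewrite !mxE mulrAC mulrC ler_wpM2r ?mul_conjC_ge0 //.
by rewrite lecR.
Qed.

(** The squared norm of a combination is the form of the Gram matrix. The coefficients are
    conjugated in [r] because forms are written with row vectors on the left. *)
Lemma trace_ctr_combination m n (F : 'I_m -> 'M[C]_n) (c : 'I_m -> C) :
  (forall i, hermitian (F i)) ->
  let r := \row_i ((c i)^*)%R in
  \tr (ctr (\sum_i c i *: F i) *m (\sum_i c i *: F i)) =
  (r *m (\matrix_(i, j) \tr (F i *m F j)) *m ctr r) 0 0.
Proof.
move=> hF r; rewrite ctr_sum mulmx_suml raddf_sum -mulmxA mxE /=.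
apply: eq_bigr => i _; rewrite ctr_scale (eqP (hF i)) mulmx_sumr raddf_sum /=.
rewrite !mxE mulr_sumr; apply: eq_bigr => j _.
by rewrite -scalemxAl -scalemxAr !mxtraceZ !mxE conjCK mulrCA mulrC !mulrA mulrAC.
Qed.

Lemma mxvec_mul_ctr m n (A B : 'M[C]_(m, n)) :
  mxvec A *m ctr (mxvec B) = (\tr (ctr B *m A))%:M.
Proof.
by rewrite [LHS]mx11_scalar -dotmx_mxvec dotmxE /ctr map_trmx.
Qed.

(** Completeness comes from counting: the identity and the M_i give n^2 orthogonal rows, so a
    one-sided inverse of the matrix they form is two-sided. Applying that inverse identity to
    [mxvec x] yields the expansion. *)
Lemma onb_traceless_expansion n (M : 'I_(n ^ 2 - 1) -> 'M[C]_n) (x : 'M[C]_n) :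
  (0 < n)%N -> onb_traceless M ->
  x = (\tr x / n%:R)%:M + \sum_i \tr (M i *m x) *: M i.
Proof.
move=> n_gt0 [hM oM]; have n0 : (n%:R : C) != 0 by rewrite pnatr_eq0 -lt0n.
have eN : (1 + (n ^ 2 - 1) = n * n)%N by rewrite subnKC ?mulnn // expn_gt0 n_gt0.
pose V := \matrix_i mxvec (M i); pose I1 : 'rV[C]_(n * n) := mxvec (1%:M : 'M[C]_n).
(* [B] is the candidate inverse of [A]; the factor 1/n appears because the identity has squared norm
   n. *)
pose A := col_mx I1 V; pose B := row_mx (n%:R^-1 *: ctr I1) (ctr V).
have VE (y : 'M[C]_n) : mxvec y *m ctr V = \row_i \tr (M i *m y).
  apply/rowP => i; rewrite [RHS]mxE -{1}(eqP (hM i).1).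
  have <- : (mxvec y *m ctr (mxvec (M i))) 0 0 = \tr (ctr (M i) *m y).
    by rewrite mxvec_mul_ctr mxE eqxx mulr1n.
  by rewrite !mxE; apply: eq_bigr => j _; rewrite !mxE.
have IE (y : 'M[C]_n) : mxvec y *m ctr I1 = (\tr y)%:M.
  by rewrite mxvec_mul_ctr /ctr map_mx1 trmx1 mul1mx.
have AB : A *m B = 1%:M.
  rewrite mul_col_row scalar_mx_block -!scalemxAr IE mxtrace1.
  congr block_mx.
  - by rewrite scale_scalar_mx mulVf.
  - by rewrite VE; apply/rowP => i; rewrite !mxE mulmx1 (hM i).2.
  - apply/matrixP => i j; rewrite ord1 mxE.
    have <- : (mxvec (M i) *m ctr I1) 0 0 = (V *m ctr I1) i 0.
      by rewrite !mxE; apply: eq_bigr => l _; rewrite !mxE.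
    by rewrite IE (hM i).2 !mxE mul0rn mulr0.
  - apply/row_matrixP => i; rewrite row_mul rowK VE row1.
    by apply/rowP => j; rewrite !mxE oM eq_sym eqxx.
(* The sizes 1 + (n^2 - 1) and n * n are not convertible, so [mulmx1C] is restated for sizes with a
   proof of equality. *)
have mulmx1C_cast p q (P : 'M[C]_(p, q)) (Q : 'M[C]_(q, p)) :
    p = q -> P *m Q = 1%:M -> Q *m P = 1%:M.
  by move=> e; move: P Q; rewrite e => P Q; exact: mulmx1C.
apply: (can_inj mxvecK); rewrite -[LHS]mulmx1 -(mulmx1C_cast _ _ _ _ eN AB).
rewrite mul_row_col mulmxDr !mulmxA -scalemxAr IE VE linearD /=; congr (_ + _).
  by rewrite scale_scalar_mx mul_scalar_mx /I1 -linearZ /= scalemx1 mulrC.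
rewrite mulmx_sum_row linear_sum /=; apply: eq_bigr => i _.
by rewrite mxE rowK linearZ.
Qed.

(** Pythagoras: scalar matrices are orthogonal to traceless ones. *)
Lemma schatten2_scalarD n (t : C) (Y : 'M[C]_n) : \tr Y = 0 ->
  (schatten2 (t%:M + Y) ^+ 2)%:C = `|t| ^+ 2 * n%:R + (schatten2 Y ^+ 2)%:C.
Proof.
move=> Y0; rewrite !schatten2_sqr_trace.
have -> : ctr (t%:M + Y) = ((t^*)%R)%:M + ctr Y.
  by rewrite /ctr map_mxD raddfD /= map_scalar_mx tr_scalar_mx.
have Y0' : \tr (ctr Y) = 0 by rewrite /ctr mxtrace_tr trace_map_mx Y0 rmorph0.
rewrite mulmxDl !mulmxDr !mul_scalar_mx !mul_mx_scalar !raddfD /= !mxtraceZ Y0 Y0'.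
by rewrite mxtrace_scalar !mulr0 addr0 add0r normCK -mulr_natr; ring.
Qed.

End UnitalMaps.

(** * The constant [gamma] and the one-map estimate *)

Section Gamma.
Context {R : realType} (n k : nat).
Local Notation C := (R[i]).
Variables (Phi : 'M[C]_n -> 'M[C]_k) (M : 'I_(n ^ 2 - 1) -> 'M[C]_n).
Hypotheses (n_gt0 : (0 < n)%N) (k_gt0 : (0 < k)%N) (hM : onb_traceless M).

Lemma Anorm_ge0 : 0 <= Anorm M Phi.
Proof. exact: bigmax_ge_id. Qed.

Lemma gamma_gt0 : 0 < gamma M Phi.
Proof.
have n0 : (0 : R) < n%:R by rewrite ltr0n.
have k0 : (0 : R) < k%:R by rewrite ltr0n.
rewrite /gamma; case: ifPn => [_|]; last rewrite -ltNge => nA.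
  rewrite ltr_wpDr ?invr_gt0 //.
  by rewrite mulr_ge0 ?Anorm_ge0 // subr_ge0 invf_le1 // ler1n.
by rewrite -(pmulr_rgt0 _ k0); exact: lt_trans nA.
Qed.

(** The case split in [gamma] is the sign of the coefficient of s. If it is nonnegative, s is raised
    to t and the two coefficients add up to [gamma]; if it is negative, the first term is dropped
    and [Anorm] remains. *)
Lemma gamma_bound (s t : R) : 0 <= s -> s <= t ->
  (k%:R^-1 - Anorm M Phi / n%:R) * s + Anorm M Phi * t <= gamma M Phi * t.
Proof.
move=> s0 st; have n0 : (0 : R) < n%:R by rewrite ltr0n.
have k0 : (0 : R) < k%:R by rewrite ltr0n.
have kA : (0 <= k%:R^-1 - Anorm M Phi / n%:R) = (k%:R * Anorm M Phi <= n%:R).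
  by rewrite subr_ge0 ler_pdivrMr // mulrC ler_pdivlMr // mulrC.
rewrite /gamma -kA; case: ifPn => [pos|]; last rewrite -ltNge => neg.
  have -> : k%:R^-1 + (1 - n%:R^-1) * Anorm M Phi =
    (k%:R^-1 - Anorm M Phi / n%:R) + Anorm M Phi by ring.
  by rewrite [leRHS]mulrDl lerD2r ler_wpM2l.
by rewrite -lerBrDr subrr mulr_le0_ge0 // ltW.
Qed.

Hypotheses (hPhi : herm_linear Phi) (uPhi : unital Phi) (tPhi : trace_preserving Phi).

Lemma eigs_Amat_le i : eigs (Amat M Phi) i <= Anorm M Phi.
Proof. exact: (@le_bigmax _ _ _ 0 (eigs (Amat M Phi))). Qed.

Lemma unital_scalar t : Phi (t%:M) = (t * n%:R / k%:R)%:M.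
Proof.
have [linPhi _] := hPhi; pose G := as_linear linPhi.
have n0 : (n%:R : C) != 0 by rewrite pnatr_eq0 -lt0n.
have -> : t%:M = (t * n%:R) *: (n%:R^-1 *: 1%:M) :> 'M[C]_n.
  by rewrite scalerA mulfK // scalemx1.
rewrite -[Phi]/(G : _ -> _) linearZ /= [X in _ *: X]uPhi.
by rewrite scalerA scalemx1.
Qed.

(** With y the traceless part of x, Phi x = (tr x / k) I + Phi y, where Phi y is again traceless.
    Pythagoras applies on both sides, and the Gram matrix [Amat] bounds |Phi y|^2 by [Anorm] |y|^2.
    Arbitrary complex x is allowed, as the matrices of entries fed to Phi later need not be
    Hermitian. *)
Lemma schatten2_unital_le (x : 'M[C]_n) :
  (schatten2 (Phi x) ^+ 2)%:C <=
  (k%:R^-1 - Anorm M Phi / n%:R)%:C * `|\tr x| ^+ 2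
  + (Anorm M Phi)%:C * (schatten2 x ^+ 2)%:C.
Proof.
have [linPhi hermPhi] := hPhi; pose G := as_linear linPhi.
have [hMi oM] := hM.
have n0 : (n%:R : C) != 0 by rewrite pnatr_eq0 -lt0n.
have k0 : (k%:R : C) != 0 by rewrite pnatr_eq0 -lt0n.
pose c i := \tr (M i *m x); pose y := \sum_i c i *: M i; pose t := \tr x.
pose r := \row_i ((c i)^*)%R.
have xE : x = (t / n%:R)%:M + y by exact: onb_traceless_expansion.
have y0 : \tr y = 0.
  by rewrite raddf_sum big1 //= => i _; rewrite mxtraceZ (hMi i).2 mulr0.
have PyE : Phi y = \sum_i c i *: Phi (M i).
  rewrite -[Phi]/(G : _ -> _) linear_sum; apply: eq_bigr => i _.
  by rewrite linearZ.
have Py0 : \tr (Phi y) = 0.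
  rewrite PyE raddf_sum big1 //= => i _.
  by rewrite mxtraceZ tPhi ?(hMi i).2 ?mulr0 //; case: (hMi i).
have PxE : Phi x = (t / k%:R)%:M + Phi y.
  rewrite {1}xE -[Phi]/(G : _ -> _) linearD; congr (_ + _).
  by rewrite [LHS]unital_scalar divfK.
have rr : (schatten2 y ^+ 2)%:C = (r *m ctr r) 0 0.
  rewrite schatten2_sqr_trace trace_ctr_combination; last by move=> i; case: (hMi i).
  suff -> : \matrix_(i, j) \tr (M i *m M j) = 1%:M by rewrite mulmx1.
  by apply/matrixP => i j; rewrite !mxE oM.
have hA : hermitian (Amat M Phi).
  apply/eqP/matrixP => i j; rewrite ctrE !mxE -trace_map_mx -mxtrace_tr map_mxM trmx_mul.
  rewrite -!/(ctr _).
  by rewrite !(eqP (hermPhi _ _)) //; [case: (hMi j)|case: (hMi i)].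
have PyA : (schatten2 (Phi y) ^+ 2)%:C <= (Anorm M Phi)%:C * (schatten2 y ^+ 2)%:C.
  rewrite rr schatten2_sqr_trace PyE trace_ctr_combination; last first.
    by move=> i; apply: hermPhi; case: (hMi i).
  exact: (hermitian_form_le _ hA eigs_Amat_le).
(* Pythagoras on the input side, solved for |y|^2; this produces the term - [Anorm] / n. *)
have xy : (schatten2 y ^+ 2)%:C = (schatten2 x ^+ 2)%:C - `|t| ^+ 2 / n%:R.
  rewrite xE schatten2_scalarD // normrM exprMn normfV normr_nat.
  by field.
rewrite PxE schatten2_scalarD // -lerBrDl; apply: le_trans PyA _.
rewrite xy normrM exprMn normfV normr_nat rmorphB /= rmorphM /= !fmorphV /= !rmorph_nat.
by rewrite le_eqVlt; apply/orP; left; apply/eqP; field; rewrite k0 n0.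
Qed.

End Gamma.

(** * Tensor products of maps, Kraus operators and quantum channels *)

Section Kraus.
Context {R : realType}.
Local Notation C := (R[i]).

Lemma tensmapE n k m l (Phi : 'M[C]_n -> 'M[C]_k) (Omega : 'M[C]_m -> 'M[C]_l)
    (X : 'M[C]_(n * m)) a a' b b' :
  tensmap Phi Omega X (mxtens_index (a, b)) (mxtens_index (a', b')) =
  \sum_i \sum_j \sum_p \sum_q X (mxtens_index (i, p)) (mxtens_index (j, q)) *
    (Phi (delta_mx i j) a a' * Omega (delta_mx p q) b b').
Proof.
rewrite /tensmap; do 4 (rewrite summxE; apply: eq_bigr => ? _).
by rewrite mxE tensmxE.
Qed.

Lemma tensmx_indexP m n p q (A B : 'M[C]_(m * p, n * q)) :
  (forall i j a b, A (mxtens_index (i, a)) (mxtens_index (j, b)) =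
     B (mxtens_index (i, a)) (mxtens_index (j, b))) -> A = B.
Proof.
move=> e; apply/matrixP => x y.
by case: (mxtens_indexP x) => i a; case: (mxtens_indexP y) => j b.
Qed.

Lemma sum_tens m n (V : nmodType) (F : 'I_(m * n) -> V) :
  \sum_x F x = \sum_i \sum_j F (mxtens_index (i, j)).
Proof.
rewrite pair_big (reindex (@mxtens_index m n)) /=.
  by apply: eq_bigr => -[].
by exists (@mxtens_unindex m n) => x _; [exact: mxtens_indexK|exact: mxtens_unindexK].
Qed.

(** Read from right to left, this expands a matrix in elementary tensors of matrix units, where maps
    defined by [tensmap] can be compared. *)
Lemma tensmap_id n m (X : 'M[C]_(n * m)) : tensmap id id X = X.
Proof.
apply: tensmx_indexP => a a' b b'; rewrite tensmapE.
rewrite (bigD1 a) //= [X in _ + X]big1 ?addr0; last first.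
  move=> i ia; rewrite big1 // => j _; rewrite big1 // => p _; rewrite big1 // => q _.
  by rewrite !mxE eq_sym (negPf ia) mul0r mulr0.
rewrite (bigD1 a') //= [X in _ + X]big1 ?addr0; last first.
  move=> j ja; rewrite big1 // => p _; rewrite big1 // => q _.
  by rewrite !mxE [a' == j]eq_sym (negPf ja) andbF mul0r mulr0.
rewrite (bigD1 b) //= [X in _ + X]big1 ?addr0; last first.
  move=> p pb; rewrite big1 // => q _.
  by rewrite !mxE [b == p]eq_sym (negPf pb) !mulr0.
rewrite (bigD1 b') //= [X in _ + X]big1 ?addr0; last first.
  by move=> q qb; rewrite !mxE [b' == q]eq_sym (negPf qb) andbF !mulr0.
by rewrite !mxE !eqxx !mulr1.
Qed.

Lemma mxtrace_tens m n (A : 'M[C]_m) (B : 'M[C]_n) : \tr (tensmx A B) = \tr A * \tr B.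
Proof.
rewrite /mxtrace sum_tens mulr_suml; apply: eq_bigr => i _.
by rewrite mulr_sumr; apply: eq_bigr => j _; rewrite tensmxE.
Qed.

Lemma ctr_tens m n p q (A : 'M[C]_(m, n)) (B : 'M[C]_(p, q)) :
  ctr (tensmx A B) = tensmx (ctr A) (ctr B).
Proof. by rewrite /ctr map_mxT trmx_tens. Qed.

Lemma tensmx_sum m n p q (I J : finType) (A : I -> 'M[C]_(m, n)) (B : J -> 'M[C]_(p, q)) :
  tensmx (\sum_i A i) (\sum_j B j) = \sum_i \sum_j tensmx (A i) (B j).
Proof.
apply: tensmx_indexP => i j a b; rewrite tensmxE !summxE mulr_suml.
apply: eq_bigr => s _; rewrite mulr_sumr summxE.
by apply: eq_bigr => t _; rewrite tensmxE.
Qed.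

(** A form of complete positivity that visibly passes to tensor products and supplies the
    factorisation Y_ij = U_i U_j^H. *)
Definition has_kraus n k (F : 'M[C]_n -> 'M[C]_k) : Prop :=
  exists (S : nat) (K : 'I_S -> 'M[C]_(k, n)),
    forall X, F X = \sum_s K s *m X *m ctr (K s).

Lemma has_kraus_id n : has_kraus (@id 'M[C]_n).
Proof.
exists 1, (fun=> 1%:M) => X.
by rewrite big_ord1 mul1mx /ctr map_mx1 trmx1 mulmx1.
Qed.

(** The Kraus operators are the products of K_s and L_t. By linearity it suffices to compare both
    sides on elementary tensors, where this is the mixed-product rule. *)
Lemma has_kraus_tens n k m l (Phi : 'M[C]_n -> 'M[C]_k) (Omega : 'M[C]_m -> 'M[C]_l) :
  has_kraus Phi -> has_kraus Omega -> has_kraus (tensmap Phi Omega).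
Proof.
move=> [S [K hK]] [T [L hL]].
exists (S * T)%N, (fun x => let st := mxtens_unindex x in tensmx (K st.1) (L st.2)) => X.
rewrite sum_tens -{2}(tensmap_id X) {1}/tensmap.
under [RHS]eq_bigr => s _ do under eq_bigr => t _ do
  rewrite mxtens_indexK /= ctr_tens /tensmap.
have e i j p q : tensmx (Phi (delta_mx i j)) (Omega (delta_mx p q)) =
    \sum_s \sum_t tensmx (K s) (L t) *m tensmx (delta_mx i j) (delta_mx p q)
      *m tensmx (ctr (K s)) (ctr (L t)).
  rewrite hK hL tensmx_sum; apply: eq_bigr => s _; apply: eq_bigr => t _.
  by rewrite -!tensmx_mul.
pose f s t : 'M[C]_(n * m) -> 'M[C]_(k * l) :=
  fun Y => tensmx (K s) (L t) *m Y *m tensmx (ctr (K s)) (ctr (L t)).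
have lf s t : linear (f s t).
  by move=> a Y Z; rewrite /f mulmxDr mulmxDl -scalemxAr -scalemxAl.
pose g s t := as_linear (lf s t).
transitivity (\sum_s \sum_t \sum_i \sum_j \sum_p \sum_q
   X (mxtens_index (i, p)) (mxtens_index (j, q)) *:
     g s t (tensmx (delta_mx i j) (delta_mx p q))); last first.
  apply: eq_bigr => s _; apply: eq_bigr => t _.
  rewrite -[RHS]/(g s t _).
  do 4 (rewrite linear_sum; apply: eq_bigr => ? _).
  by rewrite linearZ.
have exch (N : nat) (h : 'I_S -> 'I_T -> 'I_N -> 'M[C]_(k * l)) :
    \sum_s \sum_t \sum_i h s t i = \sum_i \sum_s \sum_t h s t i.
  by rewrite [RHS]exchange_big; apply: eq_bigr => s _; rewrite exchange_big.
do 4 (rewrite exch; apply: eq_bigr => ? _).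
rewrite e scaler_sumr; apply: eq_bigr => s _.
by rewrite scaler_sumr.
Qed.

Lemma has_kraus_herm_linear n k (F : 'M[C]_n -> 'M[C]_k) : has_kraus F -> herm_linear F.
Proof.
move=> [S [K hK]]; split=> [a X Y|X /eqP hX].
  rewrite !hK scaler_sumr -big_split /=; apply: eq_bigr => s _.
  by rewrite mulmxDr mulmxDl -scalemxAr -scalemxAl.
apply/eqP; rewrite hK ctr_sum; apply: eq_bigr => s _.
by rewrite !ctr_mul ctrK hX mulmxA.
Qed.

Lemma has_kraus_psd n k (F : 'M[C]_n -> 'M[C]_k) X : has_kraus F -> psd X -> psd (F X).
Proof.
move=> hF pX; split; first by case: (has_kraus_herm_linear hF) => _; apply; case: pX.
have [S [K hK]] := hF; have [_ posX] := pX => v.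
rewrite hK mulmx_sumr mulmx_suml summxE; apply: sumr_ge0 => s _.
have := posX (v *m K s); rewrite ctr_mul !mulmxA; exact.
Qed.

Lemma has_kraus_completely_positive n k (F : 'M[C]_n -> 'M[C]_k) :
  has_kraus F -> completely_positive F.
Proof.
by move=> hF r X; apply: has_kraus_psd; apply: has_kraus_tens => //; exact: has_kraus_id.
Qed.

Lemma linear_delta n k (F : 'M[C]_n -> 'M[C]_k) X : linear F ->
  F X = \sum_i \sum_j X i j *: F (delta_mx i j).
Proof.
move=> linF; pose G := as_linear linF; rewrite {1}(matrix_sum_delta X) -[F]/(G : _ -> _).
rewrite linear_sum; apply: eq_bigr => i _; rewrite linear_sum.
by apply: eq_bigr => j _; rewrite linearZ.
Qed.

(* Choi: the Kraus operators are the reshaped columns of a factor W of W W^H, the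
   image of the unnormalised maximally entangled state. *)
Lemma completely_positive_kraus m l (Omega : 'M[C]_m -> 'M[C]_l) :
  linear Omega -> completely_positive Omega -> has_kraus Omega.
Proof.
move=> linO cpO.
pose w : 'cV[C]_(m * m) :=
  \col_x ((mxtens_unindex x).1 == (mxtens_unindex x).2)%:R.
have [W eW] := psd_factor (cpO m _ (psd_mul_ctr w)).
exists (m * l)%N, (fun s => \matrix_(b, a) W (mxtens_index (a, b)) s) => X.
(* In the tensor expansion of the Choi matrix, only the term with p = i and q = j survives, since w
   w^H is an indicator of equal index pairs. *)
have choi i j b b' : Omega (delta_mx i j) b b' =
    \sum_s W (mxtens_index (i, b)) s * ((W (mxtens_index (j, b')) s)^*)%R.
  transitivity ((W *m ctr W) (mxtens_index (i, b)) (mxtens_index (j, b'))); last first.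
    by rewrite mxE; apply: eq_bigr => s _; rewrite ctrE.
  rewrite -eW tensmapE (bigD1 i) //= [X in _ + X]big1 ?addr0; last first.
    move=> i' ii; rewrite big1 // => j' _; rewrite big1 // => p _; rewrite big1 // => q _.
    by rewrite [delta_mx _ _ _ _]mxE [i == i']eq_sym (negPf ii) mul0r mulr0.
  rewrite (bigD1 j) //= [X in _ + X]big1 ?addr0; last first.
    move=> j' jj; rewrite big1 // => p _; rewrite big1 // => q _.
    by rewrite [delta_mx _ _ _ _]mxE [j == j']eq_sym (negPf jj) andbF mul0r mulr0.
  have wE a b0 a' b0' : (w *m ctr w) (mxtens_index (a, b0)) (mxtens_index (a', b0')) =
      (a == b0)%:R * (a' == b0')%:R.
    by rewrite mxE big_ord1 ctrE !mxE !mxtens_indexK /= conjC_nat.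
  rewrite (bigD1 i) //= [X in _ + X]big1 ?addr0; last first.
    move=> p pi; rewrite big1 // => q _.
    by rewrite wE eq_sym (negPf pi) !mul0r.
  rewrite (bigD1 j) //= [X in _ + X]big1 ?addr0; last first.
    by move=> q qj; rewrite wE [j == q]eq_sym (negPf qj) mulr0 mul0r.
  by rewrite wE mxE !eqxx !mul1r.
apply/matrixP => b b'; rewrite (linear_delta _ linO) !summxE.
transitivity (\sum_i \sum_j \sum_s X i j *
    (W (mxtens_index (i, b)) s * ((W (mxtens_index (j, b')) s)^*)%R)).
  apply: eq_bigr => i _; rewrite summxE; apply: eq_bigr => j _.
  by rewrite mxE choi mulr_sumr.
have exch (N M S : nat) (h : 'I_N -> 'I_M -> 'I_S -> C) :
    \sum_i \sum_j \sum_s h i j s = \sum_s \sum_j \sum_i h i j s.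
  rewrite (eq_bigr _ (fun i _ => exchange_big _ _ _ _ _ _)) exchange_big.
  by apply: eq_bigr => s _; rewrite exchange_big.
rewrite exch; apply: eq_bigr => s _; rewrite mxE; apply: eq_bigr => j _.
rewrite ctrE !mxE mulr_suml; apply: eq_bigr => i _.
by rewrite !mxE mulrA [_ * X i j]mulrC.
Qed.

(** [trace_preserving] only tests Hermitian matrices, which excludes most matrix units. Linearity
    extends it through the decomposition of X into a Hermitian and a skew-Hermitian part. *)
Lemma trace_preserving_all n k (F : 'M[C]_n -> 'M[C]_k) X :
  linear F -> trace_preserving F -> \tr (F X) = \tr X.
Proof.
move=> linF tF; pose G := as_linear linF.
pose H1 := X + ctr X; pose H2 := 'i *: (X - ctr X).
have h1 : hermitian H1.
  by apply/eqP/matrixP => a b; rewrite ctrE !mxE rmorphD /= conjCK addrC.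
have h2 : hermitian H2.
  apply/eqP/matrixP => a b; rewrite ctrE !mxE rmorphM rmorphB /= conjCK conjCi.
  by ring.
have two : (2 : C) != 0 by rewrite pnatr_eq0.
have eX : X = 2^-1 *: H1 + (- 'i / 2) *: H2.
  rewrite /H2 scalerA mulrAC mulNr -expr2 sqrCi opprK mul1r -scalerDr.
  by rewrite addrACA subrr addr0 -mulr2n -[X *+ 2]scaler_nat scalerA mulVf ?scale1r.
have t1 := tF _ h1; have t2 := tF _ h2; clearbody H1 H2.
rewrite {1}eX -[F]/(G : _ -> _) linearD !linearZ mxtraceD !mxtraceZ /= t1 t2.
by rewrite -!mxtraceZ -mxtraceD -eX.
Qed.

Lemma trace_preserving_tens n k m l (Phi : 'M[C]_n -> 'M[C]_k) (Omega : 'M[C]_m -> 'M[C]_l) :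
  linear Phi -> linear Omega -> trace_preserving Phi -> trace_preserving Omega ->
  trace_preserving (tensmap Phi Omega).
Proof.
move=> linP linO tP tO X _; rewrite -[in RHS](tensmap_id X) /tensmap.
do 4 (rewrite !raddf_sum; apply: eq_bigr => ? _).
by rewrite /= !mxtraceZ !mxtrace_tens !trace_preserving_all.
Qed.

Lemma quantum_channel_tens n k m l (Phi : 'M[C]_n -> 'M[C]_k) (Omega : 'M[C]_m -> 'M[C]_l) :
  quantum_channel Phi -> quantum_channel Omega -> quantum_channel (tensmap Phi Omega).
Proof.
move=> [[linP _] [cpP tP]] [[linO _] [cpO tO]].
have hk := has_kraus_tens (completely_positive_kraus linP cpP)
             (completely_positive_kraus linO cpO).
split; first exact: has_kraus_herm_linear.
split; [exact: has_kraus_completely_positive | exact: trace_preserving_tens].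
Qed.

Lemma quantum_channel_density n k (Phi : 'M[C]_n -> 'M[C]_k) rho :
  quantum_channel Phi -> density rho -> density (Phi rho).
Proof.
move=> [[linP _] [cpP tP]] [prho trho].
split; first by apply: has_kraus_psd => //; exact: completely_positive_kraus.
by rewrite tP //; case: prho.
Qed.

End Kraus.

(** * Comparison of the entropies of order at most 2 with the one of order 2 *)

Section Entropy.
Context {R : realType}.
Local Notation C := (R[i]).

Lemma ln_le_sub1 (x : R) : 0 < x -> ln x <= x - 1.
Proof.
move=> x0; have := @le_ln1Dx R (x - 1); rewrite (addrC 1) subrK.
by apply; rewrite ltrBrDl subrr.
Qed.

(** Bernoulli's inequality for x^b with nonpositive exponent, the power being written through [expR]
    and [ln]. *)
Lemma expR_ln_ge (b x : R) : b <= 0 -> 0 < x -> 1 + b * (x - 1) <= expR (b * ln x).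
Proof.
move=> b0 x0; apply: le_trans (expR_ge1Dx _); rewrite lerD2l.
by rewrite ler_wnM2l // ln_le_sub1.
Qed.

(** Bernoulli for exponents in [0, 1], that is, concavity of [ln]. With z = b x + (1 - b), the bound
    ln u <= u - 1 is used at u = x/z and u = 1/z; weighted by b and 1 - b, the right-hand sides sum
    to 0. *)
Lemma expR_ln_le (b x : R) : 0 <= b <= 1 -> 0 < x -> expR (b * ln x) <= 1 + b * (x - 1).
Proof.
move=> /andP[b0 b1] x0; set z := 1 + b * (x - 1).
have z0 : 0 < z.
  (* Here z is positive: b x <= 0 forces b = 0 and z = 1, and otherwise z is a positive term plus 1
     - b >= 0. *)
  rewrite /z; have [xb|bx] := leP (b * x) 0.
    have -> : b = 0 by apply/eqP; rewrite eq_le b0 andbT -(pmulr_lle0 _ x0).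
    by rewrite mul0r addr0.
  have -> : 1 + b * (x - 1) = b * x + (1 - b) by ring.
  by rewrite ltr_wpDr // subr_ge0.
rewrite -[leRHS]lnK ?posrE // ler_expR.
have h1 : ln x - ln z <= x / z - 1.
  by rewrite -ln_div ?posrE // ln_le_sub1 // divr_gt0.
have h2 : - ln z <= z^-1 - 1.
  by rewrite -lnV ?posrE // ln_le_sub1 // invr_gt0.
have e : b * (x / z - 1) + (1 - b) * (z^-1 - 1) = 0.
  have -> : b * (x / z - 1) + (1 - b) * (z^-1 - 1) = z / z - 1 by rewrite /z; ring.
  by rewrite divff ?subrr // gt_eqF.
have -> : b * ln x = b * (ln x - ln z) + (1 - b) * (- ln z) + ln z by ring.
by rewrite gerDr -e lerD // ler_wpM2l // subr_ge0.
Qed.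

Section Distribution.
Variables (I : finType) (p : I -> R).
Hypotheses (p0 : forall i, 0 <= p i) (p1 : \sum_i p i = 1).

Lemma sum_support (f : R -> R) : f 0 = 0 -> \sum_(i | 0 < p i) f (p i) = \sum_i f (p i).
Proof.
move=> f0; rewrite [RHS](bigID (fun i => 0 < p i)) /= [X in _ + X]big1 ?addr0 // => i.
by rewrite -leNgt => pi; have /eqP -> : p i == 0 by rewrite eq_le pi p0.
Qed.

(** The collision probability; [- ln T] is the entropy of order 2. *)
Let T := \sum_i p i ^+ 2.

Lemma collision_gt0 : 0 < T.
Proof.
rewrite lt_neqAle eq_sym sumr_ge0 ?andbT => [|i _]; last exact: sqr_ge0.
apply/eqP => /eqP; rewrite psumr_eq0 => [/allP e0|i _]; last exact: sqr_ge0.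
have : \sum_i p i = 0.
  apply: big1 => i _; have := e0 i (mem_index_enum i).
  by rewrite sqrf_eq0 => /eqP.
by rewrite p1 => /eqP; rewrite oner_eq0.
Qed.

Lemma collision_le1 : T <= 1.
Proof.
rewrite -p1; apply: ler_sum => i _; rewrite expr2 -[leRHS]mulr1 ler_wpM2l //.
by rewrite -p1 (bigD1 i) //= lerDl sumr_ge0.
Qed.

(** Under the weights p_i the ratio p_i / T has mean 1, so the linear term averages out. Hence
    tangent-line bounds at 1 are enough for all the entropy comparisons. *)
Lemma sum_support_affine (a b : R) :
  \sum_(i | 0 < p i) p i * (a + b * (p i / T - 1)) = a.
Proof.
rewrite (sum_support (f := fun x => x * (a + b * (x / T - 1)))) ?mul0r //.
transitivity (a * (\sum_i p i) + b * ((\sum_i p i ^+ 2) / T - \sum_i p i)).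
  rewrite mulr_suml -sumrB !mulr_sumr -big_split /=.
  by apply: eq_bigr => i _; ring.
by rewrite p1 divff ?gt_eqF ?collision_gt0 // subrr mulr0 addr0 mulr1.
Qed.

Lemma shannon_ge_collision :
  - ln T <= - \sum_(i | 0 < p i) p i * ln (p i).
Proof.
have T0 := collision_gt0; rewrite lerN2 -[leRHS](sum_support_affine _ 1).
apply: ler_sum => i pi; rewrite ler_wpM2l ?p0 // mul1r -lerBlDl.
by rewrite -ln_div ?posrE // ln_le_sub1 // divr_gt0.
Qed.

Lemma powR_collision a i : 0 < p i ->
  powR (p i) a = p i * (expR ((a - 1) * ln T) * expR ((a - 1) * ln (p i / T))).
Proof.
move=> pi; have T0 := collision_gt0.
rewrite /powR gt_eqF // -expRD -{2}(lnK (_ : p i \is Num.pos)) ?posrE // -expRD.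
by rewrite ln_div ?posrE //; congr expR; ring.
Qed.

(** Each p_i^a is p_i T^(a-1) (p_i/T)^(a-1), and Bernoulli is averaged over the last factor. For a <
    1 the sum is at least T^(a-1); for 1 < a <= 2 it is at most T^(a-1), and the negative factor
    1/(1 - a) turns the inequality round. *)
Lemma renyi_ge_collision a : 0 <= a <= 2 -> a != 1 ->
  - ln T <= (1 - a)^-1 * ln (\sum_(i | 0 < p i) powR (p i) a).
Proof.
move=> /andP[a0 a2] a1; have T0 := collision_gt0.
set E := expR ((a - 1) * ln T).
have aff : \sum_(i | 0 < p i) p i * (E * (1 + (a - 1) * (p i / T - 1))) = E.
  rewrite -[RHS](sum_support_affine _ (E * (a - 1))).
  by apply: eq_bigr => i _; ring.
have Zgt : 0 < \sum_(i | 0 < p i) powR (p i) a.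
  have [i pi] : exists i, 0 < p i.
    apply/existsP; apply: contraT; rewrite negb_exists => /forallP h.
    have : \sum_i p i <= 0 by apply: sumr_le0 => i _; rewrite leNgt.
    by rewrite p1 ler10.
  rewrite (bigD1 i) //= ltr_wpDr ?powR_gt0 //.
  by apply: sumr_ge0 => j _; exact: powR_ge0.
have lnE : ln E = (a - 1) * ln T by rewrite expRK.
case: (ltgtP a 1) a1 => // [alt|agt] _.
  have EZ : E <= \sum_(i | 0 < p i) powR (p i) a.
    rewrite -[leLHS]aff; apply: ler_sum => i pi; rewrite powR_collision //.
    rewrite ler_wpM2l ?p0 // ler_wpM2l ?expR_ge0 // expR_ln_ge ?divr_gt0 //.
    by rewrite subr_le0 ltW.
  have a10 : 0 < 1 - a by rewrite subr_gt0.
  rewrite -(ler_pM2l a10) mulrA divff ?gt_eqF // mul1r.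
  have -> : (1 - a) * - ln T = ln E by rewrite lnE; ring.
  by rewrite ler_ln ?posrE ?expR_gt0.
have EZ : \sum_(i | 0 < p i) powR (p i) a <= E.
  rewrite -[leRHS]aff; apply: ler_sum => i pi; rewrite powR_collision //.
  rewrite ler_wpM2l ?p0 // ler_wpM2l ?expR_ge0 // expR_ln_le ?divr_gt0 //.
  by apply/andP; split; lra.
have a10 : 1 - a < 0 by rewrite subr_lt0.
rewrite -(ler_nM2l a10) mulrA divff ?lt_eqF // mul1r.
have -> : (1 - a) * - ln T = ln E by rewrite lnE; ring.
by rewrite ler_ln ?posrE ?expR_gt0.
Qed.

End Distribution.

Lemma density_sum_eigs n (A : 'M[C]_n) : density A -> \sum_i eigs A i = 1.
Proof.
by move=> [[hA _] tA]; apply: complexI; rewrite -mxtrace_eigs // tA.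
Qed.

Lemma density_schatten2_gt0 n (A : 'M[C]_n) : density A -> 0 < schatten2 A.
Proof.
move=> dA; have [pA tA] := dA; have [hA _] := pA.
rewrite lt_def schatten2_ge0 andbT -sqrf_eq0 schatten2_hermitian // gt_eqF //.
exact/collision_gt0/density_sum_eigs.
Qed.

Lemma density_schatten2_le1 n (A : 'M[C]_n) : density A -> schatten2 A ^+ 2 <= 1.
Proof.
move=> dA; have [pA tA] := dA; have [hA _] := pA.
rewrite schatten2_hermitian //.
by apply: collision_le1; [move=> i; exact: psd_eigs_ge0|exact: density_sum_eigs].
Qed.

Lemma renyi_ge n (A : 'M[C]_n) (a : R) : density A -> 0 <= a <= 2 ->
  - ln (schatten2 A ^+ 2) <= renyi a A.
Proof.
move=> dA ha; have [pA _] := dA; have [hA _] := pA.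
have e0 i : 0 <= eigs A i by exact: psd_eigs_ge0.
have e1 := density_sum_eigs dA.
rewrite schatten2_hermitian // /renyi; case: ifPn => [_|a1].
  exact: shannon_ge_collision.
exact: renyi_ge_collision.
Qed.

Lemma renyi2E n (A : 'M[C]_n) : density A -> renyi 2 A = - ln (schatten2 A ^+ 2).
Proof.
move=> dA; have [pA _] := dA; have [hA _] := pA.
have e0 i : 0 <= eigs A i by exact: psd_eigs_ge0.
rewrite /renyi ifN; last by apply/eqP; lra.
have -> : (1 - 2 : R)^-1 = -1 by rewrite (_ : 1 - 2 = -1) ?invrN1 //; ring.
rewrite mulN1r schatten2_hermitian // -(sum_support (p := eigs A) _ (f := fun x => x ^+ 2)) //.
  by congr (- ln _); apply: eq_bigr => i pi; rewrite powR_mulrn // ltW.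
by rewrite expr0n.
Qed.

End Entropy.

(** * Bounds on pure inputs and their translation to [norm12] and [Smin] *)

Section PureBounds.
Context {R : realType}.
Local Notation C := (R[i]).

(** The 1-to-2 bound tested on rank-one inputs, whose trace norm is |v|^2. A common currency for
    both quantities: arguments run on an explicit constant, and [sup] and [inf] enter only at the
    ends. *)
Definition pure_bounded n k (F : 'M[C]_n -> 'M[C]_k) (c : R) : Prop :=
  forall v : 'cV[C]_n, schatten2 (F (v *m ctr v)) <= c * schatten2 v ^+ 2.

Lemma exists_unit_vector n : (0 < n)%N -> exists v : 'cV[C]_n, schatten2 v = 1.
Proof.
move=> n0; pose i0 := Ordinal n0; exists (delta_mx i0 0).
apply/eqP; rewrite -(@eqrXn2 _ 2) ?schatten2_ge0 // expr1n; apply/eqP.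
apply: complexI; rewrite schatten2_sqr (bigD1 i0) //= [X in _ + X]big1 ?addr0.
  by rewrite big_ord1 mxE !eqxx normr1 expr1n.
by move=> i ii0; rewrite big_ord1 mxE (negPf ii0) normr0 expr0n.
Qed.

Lemma pure_bounded_ge0 n k (F : 'M[C]_n -> 'M[C]_k) c :
  (0 < n)%N -> pure_bounded F c -> 0 <= c.
Proof.
move=> /exists_unit_vector[v v1] /(_ v); rewrite v1 expr1n mulr1.
by apply: le_trans; exact: schatten2_ge0.
Qed.

Lemma schatten2_eq0 m n (A : 'M[C]_(m, n)) : schatten2 A = 0 -> A = 0.
Proof.
move=> A0; have := schatten2_sqr A; rewrite A0 expr0n /= => /esym/eqP.
rewrite psumr_eq0 => [/allP e|i _]; last by apply: sumr_ge0 => j _; rewrite exprn_ge0.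
apply/matrixP => i j; rewrite mxE; have := e i (mem_index_enum i).
rewrite psumr_eq0 => [/allP /(_ j (mem_index_enum j))|j' _]; last by rewrite exprn_ge0.
by rewrite sqrf_eq0 normr_eq0 => /eqP.
Qed.

Lemma pure_bounded_unit n k (F : 'M[C]_n -> 'M[C]_k) c : linear F ->
  (forall v : 'cV[C]_n, schatten2 v = 1 -> schatten2 (F (v *m ctr v)) <= c) ->
  pure_bounded F c.
Proof.
move=> linF hF v; pose G := as_linear linF; have [v0|v0] := eqVneq (schatten2 v) 0.
  by rewrite (schatten2_eq0 v0) mul0mx -[F]/(G : _ -> _) linear0 !schatten2_0 expr0n mulr0.
pose u := (schatten2 v)^-1%:C *: v.
have u1 : schatten2 u = 1.
  by rewrite schatten2Zr ger0_norm ?invr_ge0 ?schatten2_ge0 // mulVf.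
have vE : v = (schatten2 v)%:C *: u by rewrite scalerA -rmorphM /= divff // scale1r.
have -> : v *m ctr v = (schatten2 v ^+ 2)%:C *: (u *m ctr u).
  rewrite {1 2}vE ctr_scale conj_real_complex -scalemxAl -scalemxAr scalerA.
  by rewrite -rmorphM -expr2.
rewrite -[F]/(G : _ -> _) linearZ /= schatten2Zr ger0_norm ?sqr_ge0 // mulrC.
by rewrite ler_wpM2r ?sqr_ge0 // hF.
Qed.

Lemma density_pure n (v : 'cV[C]_n) : schatten2 v = 1 -> density (v *m ctr v).
Proof.
move=> v1; split; first exact: psd_mul_ctr.
by rewrite mxtrace_mulC -schatten2_sqr_trace v1 expr1n.
Qed.

Lemma schatten2_pure n (v : 'cV[C]_n) : schatten2 (v *m ctr v) = schatten2 v ^+ 2.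
Proof.
apply/eqP; rewrite -(@eqrXn2 _ 2) ?exprn_ge0 ?schatten2_ge0 //; apply/eqP.
apply: complexI; rewrite [RHS]rmorphXn /= schatten2_sqr_trace schatten2_sqr_trace.
have sqr (w : 'M[C]_1) : \tr (w *m w) = (\tr w) ^+ 2.
  by rewrite !trace_mx11 mxE big_ord1 expr2.
by rewrite ctr_mul ctrK -mulmxA mxtrace_mulC !mulmxA -(mulmxA (ctr v *m v)) sqr.
Qed.

(** Some finite constant is needed before [norm12] can itself serve as a bound, since [sup] is
    meaningful only on sets bounded above. *)
Lemma has_kraus_pure_bounded n k (F : 'M[C]_n -> 'M[C]_k) :
  has_kraus F -> exists c, pure_bounded F c.
Proof.
move=> [S [K hK]]; exists (\sum_s schatten2 (ctr (K s) *m K s)) => v.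
rewrite hK mulr_suml; apply: le_trans (schatten2_sum _) _.
apply: ler_sum => s _; rewrite !mulmxA -mulmxA -ctr_mul schatten2_pure.
by rewrite -(schatten2_pure v) schatten2_mul.
Qed.

Lemma norm12_le n k (F : 'M[C]_n -> 'M[C]_k) c : (0 < n)%N -> linear F ->
  pure_bounded F c -> norm12 F <= c.
Proof.
move=> n0 linF hF; apply: ge_sup => [|x [rho /andP[hrho rho0] ->]]; last first.
  by rewrite ler_pdivrMr ?schatten1_gt0 // (schatten2_le_pure linF).
(* The identity shows that the set of quotients is nonempty; this uses n > 0. *)
exists (schatten2 (F 1%:M) / schatten1 (1%:M : 'M[C]_n)), 1%:M => //.
apply/andP; split; first by rewrite /hermitian /ctr map_mx1 trmx1.
by rewrite -mxrank_eq0 mxrank1 -lt0n.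
Qed.

Lemma norm12_pure_bounded n k (F : 'M[C]_n -> 'M[C]_k) :
  linear F -> (exists c, pure_bounded F c) -> pure_bounded F (norm12 F).
Proof.
move=> linF [c hF]; apply: pure_bounded_unit => // v v1.
have s1 : schatten1 (v *m ctr v) = 1 by rewrite schatten1_pure v1 expr1n.
apply: ub_le_sup.
  exists c => x [rho /andP[hrho rho0] ->].
  by rewrite ler_pdivrMr ?schatten1_gt0 // (schatten2_le_pure linF).
exists (v *m ctr v); last by rewrite s1 divr1.
have [hv _] := psd_mul_ctr v; rewrite hv /=; apply: contra_eq_neq s1 => ->.
rewrite -(mul0mx n (ctr (0 : 'M[C]_n))) schatten1_pure schatten2_0 expr0n.
by rewrite eq_sym oner_eq0.
Qed.

(** On states the trace norm is 1, so |F rho|_2 <= c, and every entropy considered is at least the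
    one of order 2, which is - ln |F rho|_2^2. *)
Lemma Smin_ge n k (F : 'M[C]_n -> 'M[C]_k) (c a : R) : (0 < n)%N ->
  quantum_channel F -> pure_bounded F c -> 0 <= a <= 2 ->
  - ln (c ^+ 2) <= Smin a F.
Proof.
move=> n0 cF hF ha; apply: lb_le_inf.
  have [v v1] := exists_unit_vector n0.
  by exists (renyi a (F (v *m ctr v))), (v *m ctr v) => //; exact: density_pure.
move=> x [rho drho ->]; have dF := quantum_channel_density cF drho.
apply: le_trans (renyi_ge dF ha); rewrite lerN2.
have [[linF _] _] := cF; have [prho trho] := drho; have [hrho _] := prho.
have s1 : schatten1 rho = 1 by apply: complexI; rewrite schatten1_psd.
have := schatten2_le_pure linF hF hrho; rewrite s1 mulr1 => le_c.
have F0 := density_schatten2_gt0 dF; have c0 := lt_le_trans F0 le_c.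
by rewrite ler_ln ?posrE ?exprn_gt0 // ler_pXn2r ?nnegrE ?(ltW F0) ?(ltW c0).
Qed.

(** The constant c solves [Smin 2 F] = - ln c^2. *)
Lemma Smin2_pure_bounded n k (F : 'M[C]_n -> 'M[C]_k) :
  quantum_channel F -> pure_bounded F (expR (- Smin 2 F / 2)).
Proof.
move=> cF; have [[linF _] _] := cF; apply: pure_bounded_unit => // v v1.
have dF := quantum_channel_density cF (density_pure v1).
have F0 := density_schatten2_gt0 dF.
have : Smin 2 F <= renyi 2 (F (v *m ctr v)).
  apply: ge_inf; last by exists (v *m ctr v) => //; exact: density_pure.
  (* Output entropies are nonnegative, so the infimum is taken over a set bounded below. *)
  exists 0 => x [rho drho ->]; have dr := quantum_channel_density cF drho.
  by rewrite renyi2E // oppr_ge0 ln_le0 // density_schatten2_le1.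
rewrite renyi2E // lnXn // => h.
rewrite -[leLHS]lnK ?posrE // ler_expR. lra.
Qed.

End PureBounds.

(** * The bound for one tensor factor *)

Section TensorBound.
Context {R : realType} (n k : nat).
Local Notation C := (R[i]).
Variables (Phi : 'M[C]_n -> 'M[C]_k) (M : 'I_(n ^ 2 - 1) -> 'M[C]_n).
Hypotheses (n_gt0 : (0 < n)%N) (k_gt0 : (0 < k)%N) (hM : onb_traceless M).
Hypotheses (hPhi : herm_linear Phi) (uPhi : unital Phi) (tPhi : trace_preserving Phi).

(** On a pure input |tr x|^2 and |x|_2^2 coincide, so [gamma_bound] applies with s = t. This is the
    base case of the N-fold product. *)
Lemma unital_pure_bounded : pure_bounded Phi (Num.sqrt (gamma M Phi)).
Proof.
move=> v; have g0 := ltW (gamma_gt0 Phi M n_gt0 k_gt0).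
rewrite -(@ler_pXn2r _ 2) ?nnegrE ?mulr_ge0 ?sqr_ge0 ?sqrtr_ge0 ?schatten2_ge0 //.
rewrite exprMn (sqr_sqrtr g0) -lecR.
apply: le_trans (schatten2_unital_le n_gt0 k_gt0 hM hPhi uPhi tPhi _) _.
have -> : \tr (v *m ctr v) = (schatten2 v ^+ 2)%:C.
  by rewrite schatten2_sqr_trace mxtrace_mulC.
rewrite schatten2_pure norm_real_complex ger0_norm ?sqr_ge0 //.
rewrite -rmorphXn -!rmorphM -rmorphD lecR.
by apply: gamma_bound => //; rewrite sqr_ge0.
Qed.

Lemma tensmap_pure_bounded m l (Omega : 'M[C]_m -> 'M[C]_l) (c : R) :
  (0 < m)%N -> has_kraus Omega -> pure_bounded Omega c ->
  pure_bounded (tensmap Phi Omega) (Num.sqrt (gamma M Phi) * c).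
Proof.
move=> m_gt0 kO hO v; have g0 := ltW (gamma_gt0 Phi M n_gt0 k_gt0).
have c0 := pure_bounded_ge0 m_gt0 hO.
have [linO _] := has_kraus_herm_linear kO; have [linP _] := hPhi.
(* [psi i] is the i-th block of v, and [x b b'] collects the (b, b') entries of all the Y_ij into
   one input for Phi. *)
pose psi i : 'cV[C]_m := \col_p v (mxtens_index (i, p)) 0.
pose Y i j := Omega (psi i *m ctr (psi j)).
pose x b b' : 'M[C]_n := \matrix_(i, j) Y i j b b'.
set Z := tensmap Phi Omega (v *m ctr v).
have ZE a b a' b' : Z (mxtens_index (a, b)) (mxtens_index (a', b')) = Phi (x b b') a a'.
  rewrite /Z tensmapE (linear_delta (x b b') linP) summxE; apply: eq_bigr => i _.
  rewrite summxE; apply: eq_bigr => j _.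
  rewrite !mxE /Y (linear_delta (psi i *m _) linO) summxE mulr_suml.
  apply: eq_bigr => p _; rewrite summxE mulr_suml; apply: eq_bigr => q _.
  by rewrite !mxE !big_ord1 !mxE [Phi _ _ _ * _]mulrC mulrA.
have ZF : (schatten2 Z ^+ 2)%:C = \sum_b \sum_b' (schatten2 (Phi (x b b')) ^+ 2)%:C.
  rewrite schatten2_sqr sum_tens exchange_big; apply: eq_bigr => b _.
  under eq_bigr => a _ do rewrite sum_tens exchange_big /=.
  rewrite exchange_big; apply: eq_bigr => b' _; rewrite schatten2_sqr.
  by apply: eq_bigr => a _; apply: eq_bigr => a' _; rewrite ZE.
pose s := schatten2 (\sum_i Y i i) ^+ 2.
pose t := \sum_i \sum_j schatten2 (Y i j) ^+ 2.
pose T := (\sum_i schatten2 (Y i i)) ^+ 2.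
have Zle : schatten2 Z ^+ 2 <=
    (k%:R^-1 - Anorm M Phi / n%:R) * s + Anorm M Phi * t.
  have sE : s%:C = \sum_b \sum_b' `|\tr (x b b')| ^+ 2.
    rewrite schatten2_sqr; apply: eq_bigr => b _; apply: eq_bigr => b' _.
    by rewrite summxE /mxtrace; congr (`|_| ^+ 2); apply: eq_bigr => i _; rewrite mxE.
  have tE : t%:C = \sum_b \sum_b' (schatten2 (x b b') ^+ 2)%:C.
    rewrite /t rmorph_sum /=; under eq_bigr => i _ do rewrite rmorph_sum /=.
    under eq_bigr => i _ do under eq_bigr => j _ do rewrite schatten2_sqr.
    under [RHS]eq_bigr => b _ do under eq_bigr => b' _ do rewrite schatten2_sqr.
    under eq_bigr => i _ do rewrite exchange_big /=.
    rewrite exchange_big; apply: eq_bigr => b _ /=.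
    under eq_bigr => i _ do rewrite exchange_big /=.
    rewrite exchange_big; apply: eq_bigr => b' _ /=.
    by apply: eq_bigr => i _; apply: eq_bigr => j _; rewrite mxE.
  rewrite -lecR ZF rmorphD (rmorphM _ _ s) (rmorphM _ _ t).
  rewrite [X in _ * X + _]sE [X in _ + _ * X]tE.
  rewrite !mulr_sumr -big_split /=; apply: ler_sum => b _.
  rewrite !mulr_sumr -big_split /=; apply: ler_sum => b' _.
  exact: schatten2_unital_le.
have sT : s <= T.
  rewrite ler_pXn2r ?nnegrE ?schatten2_ge0 ?schatten2_sum //.
  by apply: sumr_ge0 => i _; exact: schatten2_ge0.
have tT : t <= T.
  rewrite /T expr2 mulr_suml; apply: ler_sum => i _.
  rewrite mulr_sumr; apply: ler_sum => j _.
  have [S [K hK]] := kO.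
  (* The columns of [U i] are the vectors K_u psi_i, so Y_ij = sum_u K_u psi_i psi_j^H K_u^H is U_i
     U_j^H. *)
  pose U i' : 'M[C]_(l, S) := \matrix_(b, u) (K u *m psi i') b 0.
  have YU i' j' : Y i' j' = U i' *m ctr (U j').
    rewrite /Y hK; apply/matrixP => b b'; rewrite summxE mxE.
    apply: eq_bigr => u _; rewrite mulmxA -mulmxA -ctr_mul mxE big_ord1 !ctrE.
    by rewrite [U i' b u]mxE [U j' b' u]mxE.
  rewrite !YU -[schatten2 (U i *m ctr (U i))]schatten2_mulC.
  rewrite -[schatten2 (U j *m ctr (U j))]schatten2_mulC.
  by apply: le_trans (schatten2_mul _ _) _; rewrite ctrK.
(* Only diagonal blocks occur in T, and each is the image of a pure input: |Y_ii|_2 <= c |psi_i|^2,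
   where the |psi_i|^2 add up to |v|^2. *)
have TE : T <= (c * schatten2 v ^+ 2) ^+ 2.
  have -> : schatten2 v ^+ 2 = \sum_i schatten2 (psi i) ^+ 2.
    apply: complexI; rewrite rmorph_sum /= schatten2_sqr sum_tens.
    apply: eq_bigr => i _; rewrite schatten2_sqr; apply: eq_bigr => p _.
    by rewrite !big_ord1 mxE.
  have pos i : 0 <= schatten2 (Y i i) by exact: schatten2_ge0.
  rewrite ler_pXn2r ?nnegrE ?sumr_ge0 //.
    by rewrite mulr_sumr; apply: ler_sum => i _; exact: hO.
  by rewrite mulr_ge0 // sumr_ge0 // => i _; exact: sqr_ge0.
rewrite -(@ler_pXn2r _ 2) ?nnegrE ?mulr_ge0 ?sqr_ge0 ?sqrtr_ge0 ?schatten2_ge0 //.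
rewrite -mulrA exprMn (sqr_sqrtr g0); apply: le_trans Zle _.
(* Since [Anorm] is nonnegative, t can first be raised to T; then [gamma_bound] applies to s <= T
   whatever the sign of the other coefficient. *)
apply: le_trans (ler_wpM2l g0 TE).
apply: le_trans (gamma_bound Phi M n_gt0 k_gt0 (sqr_ge0 _) sT).
by rewrite lerD2l ler_wpM2l // Anorm_ge0.
Qed.

End TensorBound.

(** Induction on the list, the head acting as Phi and the tail as Omega. The tail must also be known
    to be a channel, for its Kraus form, with nonzero input dimension. The base case is a singleton,
    which [qtens_seq] leaves as it is. *)
Lemma qtens_seq_pure_bounded (R : realType) (I : Type) (Phi : I -> qmap R)
    (M : forall i, 'I_(din (Phi i) ^ 2 - 1) -> 'M[R[i]]_(din (Phi i))) (s : seq I) :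
  (forall i, (0 < din (Phi i))%N /\ (0 < dout (Phi i))%N) ->
  (forall i, quantum_channel (qfun (Phi i)) /\ unital (qfun (Phi i))) ->
  (forall i, onb_traceless (M i)) -> (0 < size s)%N ->
  let T := qtens_seq [seq Phi i | i <- s] in
  [/\ (0 < din T)%N, quantum_channel (qfun T) &
    pure_bounded (qfun T) (\prod_(i <- s) Num.sqrt (gamma (M i) (qfun (Phi i))))].
Proof.
move=> d0 hPhi hM; elim: s => [//|a [|b s] IHs] _ /=.
  have [[hl [_ tp]] uP] := hPhi a; have [n0 k0] := d0 a.
  split => //; first by case: (hPhi a).
  by rewrite big_seq1; exact: unital_pure_bounded.
have [//|dT cT pT] := IHs; have [cP uP] := hPhi a; have [n0 k0] := d0 a.
have [hl [_ tp]] := cP; have [[lT _] [cpT _]] := cT.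
split; first by rewrite muln_gt0 n0.
  exact: quantum_channel_tens.
rewrite big_cons; apply: tensmap_pure_bounded => //.
exact: completely_positive_kraus.
Qed.

Theorem theorem10 (R : realType) :
  (* part (1) *)
  (forall (n k m l : nat)
     (Phi : 'M[R[i]]_n -> 'M[R[i]]_k) (Omega : 'M[R[i]]_m -> 'M[R[i]]_l)
     (M : 'I_(n ^ 2 - 1) -> 'M[R[i]]_n),
     (0 < n)%N -> (0 < k)%N -> (0 < m)%N -> (0 < l)%N ->
     herm_linear Phi -> unital Phi -> trace_preserving Phi ->
     herm_linear Omega -> completely_positive Omega ->
     onb_traceless M ->
     norm12 (tensmap Phi Omega) <= Num.sqrt (gamma M Phi) * norm12 Omega /\
     (quantum_channel Phi -> quantum_channel Omega ->
      forall alpha : R, 0 <= alpha <= 2 ->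
        Smin alpha (tensmap Phi Omega) >= - ln (gamma M Phi) + Smin 2 Omega)) /\
  (* part (2) *)
  (forall (N : nat) (Phi : 'I_N -> qmap R)
     (M : forall i : 'I_N, 'I_(din (Phi i) ^ 2 - 1) -> 'M[R[i]]_(din (Phi i))),
     (0 < N)%N ->
     (forall i, (0 < din (Phi i))%N /\ (0 < dout (Phi i))%N) ->
     (forall i, quantum_channel (qfun (Phi i)) /\ unital (qfun (Phi i))) ->
     (forall i, onb_traceless (M i)) ->
     let T := qtens_seq [seq Phi i | i <- enum 'I_N] in
     norm12 (qfun T) <= \prod_(i < N) Num.sqrt (gamma (M i) (qfun (Phi i))) /\
     (forall alpha : R, 0 <= alpha <= 2 ->
        Smin alpha (qfun T) >= - \sum_(i < N) ln (gamma (M i) (qfun (Phi i))))).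
Proof.
split=> [n k m l Phi Omega M n0 k0 m0 l0 hPhi uPhi tPhi hO cpO hM|].
  have [linP _] := hPhi; have [linO _] := hO.
  have kO := completely_positive_kraus linO cpO.
  have nm0 : (0 < n * m)%N by rewrite muln_gt0 n0.
  have bound c : pure_bounded Omega c ->
      pure_bounded (tensmap Phi Omega) (Num.sqrt (gamma M Phi) * c).
    exact: tensmap_pure_bounded.
  split=> [|cP cO a ha].
    apply: norm12_le => //; last first.
      by apply: bound; apply: norm12_pure_bounded => //; exact: has_kraus_pure_bounded.
    (* Linearity of [tensmap] holds because the entries of X enter its defining sum linearly. *)
    move=> a X Y; rewrite /tensmap scaler_sumr -big_split /=.
    do 3 (apply: eq_bigr => ? _; rewrite scaler_sumr -big_split /=).
    by apply: eq_bigr => ? _; rewrite !mxE scalerDl scalerA.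
  (* For c = exp(- [Smin 2 Omega] / 2), the value - ln (gamma c^2) splits into the two terms
     required. *)
  have := Smin_ge nm0 (quantum_channel_tens cP cO) (bound _ (Smin2_pure_bounded cO)) ha.
  have g0 : 0 < gamma M Phi by exact: gamma_gt0.
  rewrite exprMn (sqr_sqrtr (ltW g0)) lnM ?posrE ?exprn_gt0 ?expR_gt0 //.
  rewrite lnXn ?expR_gt0 // expRK => h; apply: le_trans h.
  by rewrite opprD lerD2l; lra.
move=> N Phi M N0 d0 hPhi hM T.
have sN : (0 < size (enum 'I_N))%N by rewrite size_enum_ord.
have [dT cT] := qtens_seq_pure_bounded d0 hPhi hM sN.
rewrite -/T big_enum /= => pT; have [[linT _] _] := cT.
split=> [|a ha]; first exact: norm12_le.
have g0 i : 0 < gamma (M i) (qfun (Phi i)) by case: (d0 i) => ? ?; exact: gamma_gt0.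
apply: le_trans (Smin_ge dT cT pT ha); rewrite lerN2 -prodrXl.
under eq_bigr => i _ do rewrite (sqr_sqrtr (ltW (g0 i))).
(* Positivity of the partial products is carried through the induction because [lnM] requires it. *)
suff [_ ->] : 0 < \prod_(i < N) gamma (M i) (qfun (Phi i)) /\
    ln (\prod_(i < N) gamma (M i) (qfun (Phi i))) =
    \sum_(i < N) ln (gamma (M i) (qfun (Phi i))) by [].
apply: (big_rec2 (fun x y => 0 < x /\ ln x = y)) => [|i x y _ [x0 <-]].
  by rewrite ln1.
by rewrite mulr_gt0 // lnM ?posrE.
Qed.
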